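(* Let $m\ge 2$ and $n\ge 1$ be integers and, for $t\in\mathbb{C}\setminus\{0\}$, let $f_t(z)=t z^m\left(\frac{1-z}{1+z}\right)^n$. Let $\mathcal{A}_t$ and $\mathcal{B}_t$ be the immediate basins of the super-attracting fixed points $0$ and $\infty$ of $f_t$, and let $\alpha,\beta$ be the two free critical points of $f_t$. If $0<|t|\le 1$, then $\mathcal{A}_t$ is completely invariant; if $|t|\ge 1$, then $\mathcal{B}_t$ is completely invariant. Moreover, for every $t\in\mathbb{C}\setminus\{0\}$ at least one of the two free critical points $\alpha,\beta$ is inactive at $t$.
   Context: The free critical points of $f_t$ (independent of $t$) are $\alpha=-\frac nm+\sqrt{1+(n/m)^2}$ and $\beta=-\frac nm-\sqrt{1+(n/m)^2}$. The immediate basin of a super-attracting fixed point is the Fatou component containing it. A set $X\subset\widehat{\mathbb{C}}$ is completely invariant under $f_t$ if $f_t^{-1}(X)=X$. A free critical point $c\in\{\alpha,\beta\}$ is inactive at $t_0$ if the family of maps $t\mapsto f_t^k(c)$, $k\ge 0$, is normal on some neighbourhood of $t_0$; otherwise it is active at $t_0$. *)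

(* Defs.v *)
From HB Require Import structures.
From mathcomp Require Import all_boot all_order all_algebra complex.
From mathcomp Require Import ring lra.
From mathcomp Require Import all_classical all_reals all_analysis.

Set Implicit Arguments.
Unset Strict Implicit.
Unset Printing Implicit Defensive.

Import Order.TTheory GRing.Theory Num.Theory.
Import numFieldNormedType.Exports Normc.

Local Open Scope classical_set_scope.
Local Open Scope ring_scope.
Local Open Scope complex_scope.

HB.instance Definition _ (R : realType) := NormedModule.copy R[i] R[i]^o.

(* [None] is the point at infinity. *)
Definition sphere (R : realType) : Type := option R[i].

HB.instance Definition _ (R : realType) := Choice.on (sphere R).

Section ChordalMetric.
Variable R : realType.
Implicit Types (p q r : sphere R) (z w a b : R[i]).
Local Arguments normc : simpl never.

Definition chordal p q : R :=
  match p, q with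
  | Some z, Some w =>
      2 * normc (z - w) /
        (Num.sqrt (1 + normc z ^+ 2) * Num.sqrt (1 + normc w ^+ 2))
  | Some z, None | None, Some z => 2 / Num.sqrt (1 + normc z ^+ 2)
  | None, None => 0
  end.

(* Homogeneous coordinates [hX p : hY p], used for the triangle inequality. *)
Let hX p : R[i] := if p is Some z then z else 1.
Let hY p : R[i] := if p is Some _ then 1 else 0.
Let wedge p q : R[i] := hX p * hY q - hY p * hX q.
Let herm p q : R[i] := (hX p)^* * hX q + (hY p)^* * hY q.
Let hN p : R := Num.sqrt (normc (hX p) ^+ 2 + normc (hY p) ^+ 2).

Let normc_ge0 z : 0 <= normc z.
Proof. by case: z => a b; exact: sqrtr_ge0. Qed.

Let sqr_normcE z : normc z ^+ 2 = complex.Re z ^+ 2 + complex.Im z ^+ 2.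
Proof.
by case: z => a b /=; rewrite /normc sqr_sqrtr// addr_ge0// sqr_ge0.
Qed.

Let hN_gt0 p : 0 < hN p.
Proof.
rewrite sqrtr_gt0; case: p => [z|] /=.
- by rewrite normc1 expr1n ltr_wpDl// sqr_ge0.
- by rewrite normc1 expr1n normc0 expr0n addr0.
Qed.

Let chordalE p q : chordal p q = 2 * normc (wedge p q) / (hN p * hN q).
Proof.
case: p q => [z|] [w|] /=; rewrite /hN /wedge /=.
- by rewrite !normc1 !expr1n mulr1 mul1r ![normc _ ^+ 2 + 1]addrC.
- by rewrite !normc1 normc0 mulr0 mul1r sub0r normcN normc1 !expr1n expr0n
    addr0 sqrtr1 !mulr1 [normc _ ^+ 2 + 1]addrC.
- by rewrite !normc1 normc0 mul0r mul1r subr0 normc1 !expr1n expr0n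
    addr0 sqrtr1 mulr1 mul1r [normc _ ^+ 2 + 1]addrC.
- by rewrite mulr0 mul0r subrr normc0 mulr0 mul0r.
Qed.

Let lagrange p q : normc (herm p q) ^+ 2 + normc (wedge p q) ^+ 2 =
  (hN p * hN q) ^+ 2.
Proof.
rewrite exprMn /hN !sqr_sqrtr ?addr_ge0 ?sqr_ge0//.
rewrite /herm /wedge; case: (hX p) (hY p) (hX q) (hY q) =>
  [a1 a2] [b1 b2] [c1 c2] [d1 d2].
by rewrite !sqr_normcE /=; ring.
Qed.

Let le_herm p q : normc (herm p q) <= hN p * hN q.
Proof.
rewrite -ler_sqr ?nnegrE ?normc_ge0 ?mulr_ge0 ?(ltW (hN_gt0 _))//.
by rewrite -lagrange lerDl sqr_ge0.
Qed.

Let wedge3 p q r : (hN q ^+ 2)%:C * wedge p r =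
  herm q p * wedge q r - herm q r * wedge q p.
Proof.
rewrite /hN sqr_sqrtr ?addr_ge0 ?sqr_ge0//.
rewrite /herm /wedge !sqr_normcE.
case: (hX p) (hY p) (hX q) (hY q) (hX r) (hY r) =>
  [a1 a2] [b1 b2] [c1 c2] [d1 d2] [e1 e2] [f1 f2].
by apply/eqP; rewrite eq_complex /=; apply/andP; split; apply/eqP; ring.
Qed.

Let wedgeC p q : normc (wedge p q) = normc (wedge q p).
Proof. by rewrite -normcN /wedge opprB [hY p * _]mulrC [hX p * _]mulrC. Qed.

Lemma chordalxx p : chordal p p = 0.
Proof. by case: p => [z|] //=; rewrite subrr normc0 mulr0 mul0r. Qed.

Lemma chordal_sym p q : chordal p q = chordal q p.
Proof. by rewrite !chordalE wedgeC [hN p * _]mulrC. Qed.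

Lemma chordal_eq0 p q : chordal p q = 0 -> p = q.
Proof.
move=> /eqP; rewrite chordalE !mulf_eq0 pnatr_eq0 invr_eq0 mulf_eq0.
rewrite !(gt_eqF (hN_gt0 _)) !orbF /= => /eqP/eq0_normc; rewrite /wedge.
case: p q => [z|] [w|] //=.
- by rewrite mulr1 mul1r => /eqP; rewrite subr_eq0 => /eqP ->.
- by rewrite mulr0 mulr1 sub0r => /eqP; rewrite oppr_eq0 oner_eq0.
- by rewrite mul0r mulr1 subr0 => /eqP; rewrite oner_eq0.
Qed.

Lemma chordal_triangle q p r : chordal p r <= chordal p q + chordal q r.
Proof.
have [p0 q0 r0] := And3 (hN_gt0 p) (hN_gt0 q) (hN_gt0 r).
rewrite !chordalE -!mulrA -mulrDr ler_pM2l//.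
have H : hN q ^+ 2 * normc (wedge p r) <=
    (hN q * hN p) * normc (wedge q r) + (hN q * hN r) * normc (wedge p q).
  have -> : hN q ^+ 2 * normc (wedge p r) =
      normc ((hN q ^+ 2)%:C * wedge p r).
    by rewrite normcM /normc /= expr0n addr0 sqrtr_sqr ger0_norm// sqr_ge0.
  rewrite wedge3; apply: le_trans (le_normcD _ _) _.
  rewrite normcN !normcM [normc (wedge q p)]wedgeC.
  by apply: lerD; apply: ler_wpM2r => //; exact: le_herm.
have K : 0 < hN p * hN r * hN q ^+ 2 by rewrite !mulr_gt0// exprn_gt0.
rewrite -(ler_pM2r K).
have -> : normc (wedge p r) / (hN p * hN r) * (hN p * hN r * hN q ^+ 2) =
   hN q ^+ 2 * normc (wedge p r) by field; rewrite ?gt_eqF.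
apply: le_trans H _; rewrite le_eqVlt; apply/orP; left; apply/eqP.
by field; rewrite ?gt_eqF.
Qed.

HB.instance Definition _ := @isMetric.Build R (sphere R) chordal
  chordalxx chordal_eq0 chordal_sym chordal_triangle.

End ChordalMetric.

(* Normality with respect to the chordal metric; the limit may take the value
   infinity. Only the values of the maps on the open set U matter. *)
Definition normal_on (R : realType) (X : topologicalType) (U : set X)
    (F : set (X -> sphere R)) : Prop :=
  forall u : nat -> X -> sphere R, (forall k, F (u k)) ->
  exists phi : nat -> nat, {homo phi : i j / (i < j)%N} /\
  exists g : X -> sphere R,
    {family [set K : set X | compact K /\ K `<=` U],
       (fun k => u (phi k)) @ \oo --> g}.

Definition fatou_set (R : realType) (f : sphere R -> sphere R) :
    set (sphere R) :=
  [set z | exists2 U, open_nbhs z U &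
             normal_on U (range (fun k : nat => iter k f))].

Definition immediate_basin (R : realType) (f : sphere R -> sphere R)
    (p : sphere R) : set (sphere R) :=
  connected_component (fatou_set f) p.

Definition completely_invariant (R : realType) (f : sphere R -> sphere R)
    (X : set (sphere R)) : Prop :=
  f @^-1` X = X.

(* The extension of t z^m ((1 - z) / (1 + z))^n to the sphere: for t <> 0 and
   m, n >= 1 both -1 and infinity are poles. *)
Definition fmn (R : realType) (m n : nat) (t : R[i]) (p : sphere R) :
    sphere R :=
  if p is Some z then
    if z == -1 then None
    else Some (t * z ^+ m * ((1 - z) / (1 + z)) ^+ n)
  else None.

Definition alpha (R : realType) (m n : nat) : R[i] :=
  (- (n%:R / m%:R) + Num.sqrt (1 + (n%:R / m%:R) ^+ 2))%:C.

Definition beta (R : realType) (m n : nat) : R[i] :=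
  (- (n%:R / m%:R) - Num.sqrt (1 + (n%:R / m%:R) ^+ 2))%:C.

(* The parameter ranges over the punctured plane, hence [U `<=` ...]. *)
Definition inactive (R : realType) (m n : nat) (c t0 : R[i]) : Prop :=
  exists U : set R[i], [/\ open_nbhs t0 U, U `<=` [set t | t != 0] &
    normal_on U (range (fun (k : nat) (t : R[i]) =>
                          iter k (fmn m n t) (Some c)))].

(* Main.v *)
Require Import Defs.
From HB Require Import structures.
From mathcomp Require Import all_boot all_order all_algebra complex.
From mathcomp Require Import ring lra.
From mathcomp Require Import all_classical all_reals all_analysis.
Set Implicit Arguments.
Unset Strict Implicit.
Unset Printing Implicit Defensive.

Import Order.TTheory GRing.Theory Num.Theory.
Import numFieldNormedType.Exports Normc.

Local Open Scope classical_set_scope.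
Local Open Scope ring_scope.
Local Open Scope complex_scope.

(* For |t| <= 5/4 the disc |z| <= 1/(2n+1) is contracted towards 0, and f_t maps
   [0, 1] into it because x^2 ((1-x)/(1+x))^n <= x^2/(1+nx)^2 <= 1/(4n) there.
   Hence [0, 1], which contains 0, 1 and alpha, lies in the basin of 0. The
   immediate basin A contains the fiber {0, 1} of 0, and f_t is open and closed,
   so every nonempty clopen part of the preimage of A maps onto A and meets
   [0, 1]: the preimage of A is connected, hence contained in A. The case of
   infinity, and of beta = -1/alpha, follows from the conjugacy z |-> -1/z, which
   replaces t by (-1)^(m+n+1)/t. *)

Local Arguments normc : simpl never.

(** * Topology and attracting basins *)

(** The immediate basin is a component of the Fatou set, so its points must first be shown to be
    attracted to the centre at all. This is the purpose of [fatou_closure_basin]: it makes the basin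
    relatively closed in the Fatou set, and connectedness does the rest. After that, an inclusion
    into the immediate basin only asks for a connected subset of the basin containing the centre
    ([connected_basin_sub]); forward invariance, the interval, the preimage and the conjugacy all go
    through this criterion. Openness and closedness of f_t come from locating roots: the modulus of
    a polynomial at x is that of its leading coefficient times the product of the distances from x
    to its roots. Without the margin 5/4 the circle |t| = 1 would have no neighbourhood on which
    either estimate holds, and inactivity there would be out of reach. *)

Lemma cvg_seq_compact (T : topologicalType) (w : nat -> T) (z : T) :
  w @ \oo --> z -> compact (z |` range w).
Proof.
move=> wz F PF FK.
(* If [F] does not cluster at z, some neighbourhood [B] of z misses a member of [F]. Only finitely
   many terms lie outside [B], so [F] lives on a finite set, which is compact. *)
have [Fz|nFz] := pselect (cluster F z); first by exists z; split => //; left.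
have [A [B [FA zB AB]]] : exists A B, [/\ F A, nbhs z B & A `&` B = set0].
  apply: contrapT => H; apply: nFz => A B FA zB; apply: contrapT => AB.
  by apply: H; exists A, B; split => //; apply/eqP/negPn/negP => /set0P.
have [N _ NB] := wz _ zB.
have fin : finite_set (w @` `I_N) by apply: finite_image; exact: finite_II.
have FI : F (w @` `I_N).
  apply: filterS (filterI FA FK) => x [Ax].
  have nB : ~ B x by move=> Bx; have : (A `&` B) x by []; rewrite AB.
  case=> [xz|[i _ wi]]; first by case: nB; rewrite xz; exact: nbhs_singleton zB.
  exists i => //=; rewrite ltnNge; apply/negP => Ni; apply: nB.
  by rewrite -wi; exact: NB.
have [x [[i _ <-] Cx]] := finite_compact fin PF FI.
by exists (w i); split => //; right; exists i.
Qed.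

Lemma uniform_ballP (R : numFieldType) (X : choiceType) (V : pseudoMetricType R)
    (A : set X) (u : nat -> X -> V) (g : X -> V) :
  {uniform A, u @ \oo --> g} <->
  forall e, 0 < e -> \forall k \near \oo, forall x, A x -> ball (g x) e (u k x).
Proof.
split=> [H e e0|H P /uniform_nbhs[E [entE EP]]].
  apply: (H [set h : X -> V | forall x, A x -> ball (g x) e (h x)]).
  apply/uniform_nbhs; exists [set xy | ball xy.1 e xy.2].
  by split => //; exact: entourage_ball (PosNum e0).
move: entE; rewrite -entourage_ballE => -[e /= e0 eE].
have := H _ e0; apply: filterS => k Hk; apply: EP => x Ax.
by apply: eE; exact: Hk.
Qed.

Lemma inf_often_subseq (P : nat -> Prop) :
  (forall N, exists2 i, (N <= i)%N & P i) ->
  exists phi : nat -> nat, {homo phi : i j / (i < j)%N} /\ forall i, P (phi i).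
Proof.
move=> H.
have /choice[nxt nxtP] : forall N, exists i, (N <= i)%N /\ P i.
  by move=> N; have [l] := H N; exists l.
pose phi k := iter k (fun i => nxt i.+1) (nxt 0%N).
exists phi; split; last by case=> [|k]; exact: (nxtP _).2.
by apply: homo_ltn => [|k]; [exact: ltn_trans|exact: (nxtP _).1].
Qed.

(** A sequence drawn from the range may repeat indices. Either some index recurs infinitely often,
    giving a constant subsequence, or the indices tend to infinity and the sequence itself converges
    to [g]. *)
Lemma normal_range_uniform_cvg (R : realType) (X : topologicalType)
    (U : set X) (h : nat -> X -> sphere R) (g : X -> sphere R) :
  {uniform U, h @ \oo --> g} -> normal_on U (range h).
Proof.
move=> /uniform_ballP hg u Fu.
have /choice[j uj] : forall k, exists i, h i = u k.
  by move=> k; have [i _] := Fu k; exists i.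
have [[v vP]|nv] := pselect (exists v, forall N, exists2 i, (N <= i)%N & j i = v).
  have [phi [phiH phiv]] := inf_often_subseq vP.
  exists phi; split => //; exists (h v); apply/fam_cvgP => K _.
  apply/uniform_ballP => e e0; near=> k => x _.
  by rewrite -uj phiv; exact: ballxx.
have jinf M : \forall i \near \oo, (M <= j i)%N.
  elim: M => [|M IH]; first by near=> i.
  have [N _ NM] : \forall i \near \oo, j i <> M.
    apply: contrapT => nN; apply: nv; exists M => N; apply: contrapT => nM.
    apply: nN; exists N => // i /= Ni jM; apply: nM; by exists i.
  near=> i; rewrite ltn_neqAle; apply/andP; split.
    by apply/eqP => /esym; apply: NM => /=; near: i; exact: nbhs_infty_ge.
  by near: i.
exists id; split => //; exists g; apply/fam_cvgP => K [_ KU].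
apply/uniform_ballP => e e0; have [N _ Ne] := hg _ e0.
near=> k => x Kx; rewrite -uj; apply: Ne; last exact: KU.
by rewrite /=; near: k; exact: jinf.
Unshelve. all: by end_near. Qed.

Section AttractingBasin.
Variables (R : realType) (f : sphere R -> sphere R) (p : sphere R).
Variable D : set (sphere R).
Hypotheses (fc : continuous f) (oD : open D) (Dp : D p).
Hypothesis Dunif : {uniform D, (fun k => iter k f) @ \oo --> (cst p)}.

(** Entry into [D] is used instead of convergence to [p], so that the basin is visibly a union of
    open preimages; convergence is recovered in [basin_cvg]. *)
Definition basin : set (sphere R) := [set z | exists k, D (iter k f z)].

Lemma iter_continuous k : continuous (iter k f).
Proof.
elim: k => [|k IH] x; first exact: cvg_id.
rewrite (_ : iter k.+1 f = f \o iter k f)//.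
by apply: continuous_comp; [exact: IH|exact: fc].
Qed.

Lemma iter_preimage_open k : open (iter k f @^-1` D).
Proof. by apply: open_comp => // x _; exact: iter_continuous. Qed.

Lemma basin_open : open basin.
Proof.
have -> : basin = \bigcup_k (iter k f @^-1` D).
  by apply/seteqP; split=> z [k]; [exists k|move=> ? ?; exists k].
by apply: bigcup_open => k _; exact: iter_preimage_open.
Qed.

(** Around a point that enters [D] at time k, the later iterates are iterates on [D] precomposed
    with the k-th one, so they converge uniformly to [p]. *)
Lemma basin_sub_fatou : basin `<=` fatou_set f.
Proof.
move=> z [k Dk]; exists (iter k f @^-1` D).
  by split => //; exact: iter_preimage_open.
apply: (@normal_range_uniform_cvg _ _ _ _ (cst p)).
move/uniform_ballP : Dunif => H.
apply/uniform_ballP => e e0; have [N _ Ne] := H _ e0.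
near=> j => x Dx; have kj : (k <= j)%N by near: j; exact: nbhs_infty_ge.
rewrite -(subnK kj) iterD; apply: Ne => //=.
by rewrite leq_subRL//; near: j; exact: nbhs_infty_ge.
Unshelve. all: by end_near. Qed.

Lemma basin_cvg z : basin z -> (fun k => iter k f z) @ \oo --> p.
Proof.
move=> [k Dk]; apply/cvg_ballP => e e0.
move/uniform_ballP : Dunif => /(_ _ e0) [N _ Ne].
near=> j; have kj : (k <= j)%N by near: j; exact: nbhs_infty_ge.
rewrite -(subnK kj) iterD; apply: (Ne (j - k)%N) => //=.
by rewrite leq_subRL//; near: j; exact: nbhs_infty_ge.
Unshelve. all: by end_near. Qed.

(* The limit of a normal subsequence is constantly p on the basin; uniform
   convergence along a sequence of basin points together with its limit z then
   brings some iterate of z into D. *)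
Lemma fatou_closure_basin : fatou_set f `&` closure basin `<=` basin.
Proof.
move=> z [[U [oU Uz] nU] clz].
have /choice[w wP] : forall i : nat, exists w,
    [/\ basin w, U w & ball z i.+1%:R^-1 w].
  move=> i.
  have [w [bw [Uw zw]]] : basin `&` (U `&` ball z i.+1%:R^-1) !=set0.
    apply: clz; apply: filterI; first exact: open_nbhs_nbhs.
    by apply: nbhsx_ballx; rewrite invr_gt0.
  by exists w.
have wz : w @ \oo --> z.
  apply/cvg_ballP => e e0; near=> i; have [_ _] := wP i.
  apply: le_ball; rewrite ltW//; near: i; exact: near_infty_natSinv_lt (PosNum e0).
have := nU (fun k => iter k f) (fun k => ex_intro2 _ _ k I erefl).
move=> [phi [phiH [g /fam_cvgP gfam]]].
have Kfam : [set K | compact K /\ K `<=` U] (z |` range w).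
  split; first exact: cvg_seq_compact.
  by move=> x [->//|[i _ <-]]; have [] := wP i.
have /uniform_ballP gP := gfam _ Kfam.
have [e /= e0 eD] : exists2 e : R, 0 < e & ball p e `<=` D.
  by apply/nbhs_ballP; exact: open_nbhs_nbhs.
have phi_ge k : (k <= phi k)%N.
  elim: k => // k IH; apply: leq_ltn_trans IH _; exact: phiH.
(* At the basin points w_i pointwise convergence to [p] is known, so uniqueness of limits identifies
   [g] there. *)
have gw i : g (w i) = p.
  have c1 : (fun k => iter (phi k) f (w i)) @ \oo --> p.
    have [bw _ _] := wP i; apply: cvg_trans (basin_cvg bw) => A /= [N _ NA].
    exists N => // k /= Nk; apply: NA => /=; exact: leq_trans Nk (phi_ge k).
  have c2 : (fun k => iter (phi k) f (w i)) @ \oo --> g (w i).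
    apply/cvg_ballP => d d0; apply: filterS (gP _ d0) => k; apply; right.
    by exists i.
  have hs : hausdorff_space (sphere R) by exact: (@metric_hausdorff R (sphere R)).
  exact: (cvg_unique hs c2 c1).
have e2 : 0 < e / 2 by rewrite divr_gt0.
(* The time k is fixed first, uniformly in i; continuity of this single iterate at z then selects
   i. *)
have [k _ /(_ k (leqnn _)) gk] := gP _ e2.
have fkz : iter (phi k) f (w i) @[i --> \oo] --> iter (phi k) f z.
  apply: (@cvg_comp _ _ _ w (iter (phi k) f)) wz _; exact: iter_continuous.
have [i _ /(_ i (leqnn _)) fi] := (cvg_ballP _ _).1 fkz _ e2.
exists (phi k); apply: eD; rewrite [e]splitr; apply: ball_triangle (ball_sym fi).
by rewrite -(gw i); apply: gk; right; exists i.
Unshelve. all: by end_near. Qed.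

(** The basin meets the component in a relatively clopen set containing [p]: open by [basin_open],
    closed by [fatou_closure_basin]. *)
Lemma immediate_basin_sub : immediate_basin f p `<=` basin.
Proof.
set A := immediate_basin f p.
have bp : basin p by exists 0%N.
have Ap : A p by apply: connected_component_refl; exact: basin_sub_fatou.
suff <- : A `&` basin = A by move=> x [].
apply: (component_connected (A := fatou_set f) (x := p)).
- by exists p.
- by exists basin => //; exact: basin_open.
- exists (closure basin); first exact: closed_closure.
  apply/seteqP; split=> x [Ax bx]; split=> //; first exact: subset_closure.
  by apply: fatou_closure_basin; split => //; exact: connected_component_sub Ax.
Qed.

Lemma connected_basin_sub (B : set (sphere R)) :
  connected B -> B p -> B `<=` basin -> B `<=` immediate_basin f p.
Proof.
move=> cB Bp Bb; apply: connected_component_max => //.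
exact: subset_trans basin_sub_fatou.
Qed.

Lemma immediate_basin_center : immediate_basin f p p.
Proof. by apply: connected_component_refl; apply: basin_sub_fatou; exists 0%N. Qed.

End AttractingBasin.

(* The hypotheses on f say that it is open and closed near the fibers over A; a
   clopen part of the preimage then has a clopen image, hence meets the fiber
   over s. *)
Lemma connected_preimage (T S : topologicalType) (f : T -> S) (A : set S)
    (L : set T) (s : S) :
  connected A -> A s -> connected L -> L !=set0 -> f @` L `<=` A ->
  f @^-1` [set s] `<=` L ->
  (forall x O, A (f x) -> nbhs x O -> nbhs (f x) (f @` O)) ->
  (forall y O, A y -> open O -> f @^-1` [set y] `<=` O ->
     \forall y' \near y, f @^-1` [set y'] `<=` O) ->
  connected (f @^-1` A).
Proof.
move=> cA As cL [l Ll] LA sL fo fcl.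
have clopen_empty O O' : open O -> open O' -> f @^-1` A `<=` O `|` O' ->
    f @^-1` A `&` (O `&` O') = set0 -> L `<=` O' -> f @^-1` A `&` O = set0.
  move=> oO oO' VOO' disj LO'; apply/eqP/negPn/negP => /set0P[q [Aq Oq]].
  pose G := [set y | A y /\ exists2 x, O x & f x = y].
  have SA : G = A.
    apply: cA; first by exists (f q); split => //; exists q.
    (* The implication [A y -> G y] turns openness relative to [A] into a genuine open set. *)
    - exists (interior [set y | A y -> G y]); first exact: open_interior.
      apply/seteqP; split=> y [Ay]; last first.
        by move=> /interior_subset; exact.
      move=> [x Ox fxy]; split => //; rewrite /interior /= -fxy.
      have : nbhs (f x) (f @` O).
        by apply: fo; [rewrite fxy|exact: open_nbhs_nbhs].
      by apply: filterS => y' [x' Ox' <-]; split => //; exists x'.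
    (* If y in [A] is not a value on [O], its whole fiber lies in [O']; by [fcl] so do the nearby
       fibers, and none of them meets [O]. *)
    - exists (~` interior [set y | A y -> ~ G y]).
        by rewrite closedC; exact: open_interior.
      apply/seteqP; split=> y [Ay]; first by move=> Sy; split => // /interior_subset; exact.
      move=> nI; apply: contrapT => nS; apply: nI; rewrite /interior /=.
      have := fcl y O' Ay oO'.
      have fO' : f @^-1` [set y] `<=` O'.
        move=> x /= fxy; have : (f @^-1` A) x by rewrite /= fxy.
        move=> /VOO'[Ox|//]; exfalso; apply: nS; split => //; exists x => //.
      move=> /(_ fO'); apply: filterS => y' fy' Ay' [_ [x Ox fxy']].
      have : (f @^-1` A `&` (O `&` O')) x.
        by split; [rewrite /= fxy'|split => //; exact: fy'].
      by rewrite disj.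
  have [_ [x Ox fxs]] : G s by rewrite SA.
  have : (f @^-1` A `&` (O `&` O')) x.
    by split; [rewrite /= fxs|split => //; apply: LO'; exact: sL].
  by rewrite disj.
move=> B [b Bb] [ O oO BO] [C cC BC].
have VOC : f @^-1` A `<=` O `|` ~` C.
  move=> x Vx; have [Cx|nCx] := pselect (C x); [left|by right].
  by have : B x; [rewrite BC|rewrite BO => -[]].
have disj : f @^-1` A `&` (O `&` ~` C) = set0.
  rewrite -subset0 => x [Vx [Ox nCx]]; apply: nCx.
  by have : B x; [rewrite BO|rewrite BC => -[]].
have LV : L `<=` f @^-1` A by move=> x Lx; apply: LA; exists x.
(* The connected set [L] lies on one side of the separation, and [clopen_empty] then empties the
   other side. *)
have sepL : L `<=` O \/ L `<=` ~` C.
  have [BL0|/set0P BL0] := eqVneq (L `&` O) set0.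
    right=> x Lx; have [Ox|//] := VOC _ (LV _ Lx).
    by have : (L `&` O) x by []; rewrite BL0.
  left; suff <- : L `&` O = L by move=> x [].
  apply: cL => //; first by exists O.
  exists C => //; apply/seteqP; split=> x [Lx H]; split => //.
    by have : B x; [rewrite BO; split => //; exact: LV|rewrite BC => -[]].
  by have : B x; [rewrite BC; split => //; exact: LV|rewrite BO => -[]].
have oC : open (~` C) by exact: closed_openC.
have [LO|LC] := sepL; last first.
  have := clopen_empty _ _ oO oC VOC disj LC.
  by rewrite -BO => B0; move: Bb; rewrite B0.
have : f @^-1` A `&` ~` C = set0.
  by apply: (clopen_empty _ O) => //; [rewrite setUC|rewrite [~` C `&` _]setIC].
move=> VC0; rewrite BC; apply/seteqP; split=> x; first by case.
move=> Vx; split => //; apply: contrapT => nC.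
by have : (f @^-1` A `&` ~` C) x by []; rewrite VC0.
Qed.

(** * The chordal metric *)

Section ComplexNorm.
Variable R : realType.
Implicit Types z w : R[i].

Lemma normc_ge0 z : 0 <= normc z.
Proof. by case: z => a b; exact: sqrtr_ge0. Qed.

Lemma normc_eq0 z : (normc z == 0) = (z == 0).
Proof. by apply/eqP/eqP => [/eq0_normc//|->]; exact: normc0. Qed.

Lemma normc_gt0 z : (0 < normc z) = (z != 0).
Proof. by rewrite lt_def normc_ge0 andbT normc_eq0. Qed.

Lemma normcX z k : normc (z ^+ k) = normc z ^+ k.
Proof. by elim: k => [|k IH]; rewrite ?expr0 ?normc1// !exprS normcM IH. Qed.

Lemma normc_distC z w : normc (z - w) = normc (w - z).
Proof. by rewrite -normcN opprB. Qed.

Lemma ler_normcB z w : normc z - normc w <= normc (z - w).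
Proof. by rewrite lerBlDr; have := le_normcD (z - w) w; rewrite subrK. Qed.

Lemma normc_real (x : R) : normc x%:C = `|x|.
Proof. by rewrite /normc /= expr0n /= addr0 sqrtr_sqr. Qed.

Lemma nbhs_complexP z (U : set R[i]) :
  nbhs z U <-> exists2 d : R, 0 < d & forall w, normc (z - w) < d -> U w.
Proof.
split=> [/nbhs_ballP[e /= e0 eU]|[d d0 dU]].
  have [e1 eE] : exists e1 : R, e = e1%:C.
    by exists (complex.Re e); move: e0; case: (e) => a b; rewrite ltcE /= => /andP[/eqP-> _].
  move: e0; rewrite eE ltcR => e0; exists e1 => // w zw; apply: eU.
  by rewrite eE /ball /= ltcR.
apply/nbhs_ballP; exists d%:C; first by rewrite /= ltcR.
by move=> w; rewrite /ball /= ltcR; exact: dU.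
Qed.

Lemma sqrt1_sqr_gt0 (a : R) : 0 < Num.sqrt (1 + a ^+ 2).
Proof. by rewrite sqrtr_gt0 ltr_pwDl// sqr_ge0. Qed.

Lemma sqrt1_sqr_ge1 (a : R) : 1 <= Num.sqrt (1 + a ^+ 2).
Proof. by rewrite -[leLHS]sqrtr1 ler_wsqrtr// lerDl sqr_ge0. Qed.

Lemma sqrt1_sqr_le (a : R) : 0 <= a -> Num.sqrt (1 + a ^+ 2) <= 1 + a.
Proof.
move=> a0; rewrite -[leRHS]ger0_norm ?addr_ge0// -sqrtr_sqr ler_wsqrtr//.
by rewrite sqrrD expr1n mul1r lerD2r lerDl mulrn_wge0.
Qed.

Lemma chordal_fin_le z w :
  chordal (Some z) (Some w) <= 2 * normc (z - w).
Proof.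
rewrite /= ler_pdivrMr ?mulr_gt0 ?sqrt1_sqr_gt0//.
rewrite ler_peMr ?mulr_ge0 ?normc_ge0//.
by rewrite -[leLHS]mulr1 ler_pM// sqrt1_sqr_ge1.
Qed.

Lemma nbhs_SomeP z (U : set (sphere R)) :
  nbhs (Some z : sphere R) U <->
  exists2 d : R, 0 < d & forall w, normc (z - w) < d -> U (Some w).
Proof.
split=> [/nbhs_ballP[e /= e0 eU]|[d d0 dU]].
  exists (e / 2); first by rewrite divr_gt0.
  move=> w zw; apply: eU; apply: le_lt_trans (chordal_fin_le z w) _.
  by rewrite mulrC -ltr_pdivlMr.
set a := normc z; have a0 : 0 <= a by exact: normc_ge0.
(* The first bound is the distance from z to infinity and excludes infinity. The second comes from
   chordal >= 2x / (s (1 + a + x)) with x = |z - w| and s = sqrt (1 + a^2): this is increasing in x,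
   so x >= d would push w out of the ball. *)
pose e := Num.min (2 / Num.sqrt (1 + a ^+ 2))
  (2 * d / (Num.sqrt (1 + a ^+ 2) * (1 + a + d))).
have s0 := sqrt1_sqr_gt0 a.
have e0 : 0 < e.
  by rewrite lt_min !divr_gt0 ?mulr_gt0//; apply: addr_gt0 => //; exact: ltr_pwDl.
apply/nbhs_ballP; exists e => //= -[w|]; last first.
  by rewrite /ball/= -/a lt_min ltxx.
rewrite /ball/= => H; apply: dU; rewrite ltNge; apply/negP => dzw.
move: H; apply/negP; rewrite -leNgt ge_min; apply/orP; right.
rewrite -/a ler_pdivrMr ?mulr_gt0//; last by apply: addr_gt0 => //; exact: ltr_pwDl.
set x := normc (z - w) in dzw *; have x0 : 0 <= x by exact: normc_ge0.
have wle : Num.sqrt (1 + normc w ^+ 2) <= 1 + a + x.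
  apply: le_trans (sqrt1_sqr_le (normc_ge0 w)) _; rewrite -addrA lerD2l.
  by have := ler_normcB w z; rewrite normc_distC -/a -/x; lra.
have b0 := sqrt1_sqr_gt0 (normc w); set b := Num.sqrt (1 + normc w ^+ 2) in wle b0 *.
set s := Num.sqrt _ in s0 *.
have -> : 2 * x / (s * b) * (s * (1 + a + d)) = 2 * (x * (1 + a + d)) / b.
  by field; rewrite !gt_eqF.
rewrite ler_pdivlMr// -mulrA ler_pM2l//.
by apply: le_trans (ler_wpM2l (ltW d0) wle) _; nra.
Qed.

Lemma Some_continuous : continuous (Some : R[i] -> sphere R).
Proof.
by move=> z U /nbhs_SomeP[d d0 dU]; apply/nbhs_complexP; exists d.
Qed.

Definition sigma (p : sphere R) : sphere R :=
  if p is Some z then if z == 0 then None else Some (- z^-1) else Some 0.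

Lemma sigmaK : involutive sigma.
Proof.
case=> [z|] /=; last by rewrite eqxx.
have [->//|z0] := eqVneq z 0.
by rewrite /= oppr_eq0 invr_eq0 (negbTE z0) invrN opprK invrK.
Qed.

Lemma sqrt1_sqrV (a : R) : 0 < a ->
  Num.sqrt (1 + a^-1 ^+ 2) = Num.sqrt (1 + a ^+ 2) / a.
Proof.
move=> a0; have -> : 1 + a^-1 ^+ 2 = (1 + a ^+ 2) * (a^-1) ^+ 2.
  by field; rewrite gt_eqF.
rewrite sqrtrM ?addr_ge0 ?sqr_ge0// sqrtr_sqr ger0_norm//.
by rewrite invr_ge0 ltW.
Qed.

(** [sigma] is the half turn of the sphere fixing i and -i. Being an isometry, it transports uniform
    convergence between the basins of 0 and infinity. *)
Lemma chordal_sigma p q : chordal (sigma p) (sigma q) = chordal p q.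
Proof.
have cN z : chordal (sigma (Some z)) (sigma None) = chordal (Some z) None.
  rewrite /=; have [->|z0] := eqVneq z 0.
    by rewrite /= normc0 expr0n addr0 sqrtr1.
  have nz : 0 < normc z by rewrite normc_gt0.
  rewrite /= subr0 normcN normcV normc0 expr0n /= addr0 sqrtr1 mulr1 sqrt1_sqrV//.
  by field; rewrite !gt_eqF// sqrt1_sqr_gt0.
have c0 z : chordal (sigma (Some z)) (sigma (Some 0)) = chordal (Some z) (Some 0).
  rewrite /= eqxx; have [->|z0] := eqVneq z 0.
    by rewrite /= subrr normc0 mulr0 mul0r.
  have nz : 0 < normc z by rewrite normc_gt0.
  rewrite /= subr0 normcN normcV normc0 expr0n /= addr0 sqrtr1 mulr1 sqrt1_sqrV//.
  by field; rewrite !gt_eqF// sqrt1_sqr_gt0.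
case: p q => [z|] [w|]; [|exact: cN| |].
- have [->|z0] := eqVneq z 0; first by rewrite chordal_sym c0 chordal_sym.
  have [->|w0] := eqVneq w 0; first exact: c0.
  have nz : 0 < normc z by rewrite normc_gt0.
  have nw : 0 < normc w by rewrite normc_gt0.
  rewrite /= (negbTE z0) (negbTE w0) /= !normcN !normcV !sqrt1_sqrV//.
  have -> : - z^-1 - - w^-1 = (z - w) * (z^-1 * w^-1) by field; rewrite z0 w0.
  rewrite !normcM !normcV.
  by field; rewrite !gt_eqF// sqrt1_sqr_gt0.
- by rewrite chordal_sym cN chordal_sym.
- by rewrite chordalxx.
Qed.

Lemma sigma_ball p q e : ball (sigma p) e (sigma q) <-> ball p e q.
Proof. by rewrite /ball /= chordal_sigma. Qed.

Lemma sigma_continuous : continuous sigma.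
Proof.
move=> p U /nbhs_ballP[e /= e0 eU]; apply/nbhs_ballP; exists e => //= q pq.
by apply: eU; exact/sigma_ball.
Qed.

End ComplexNorm.

(** * Continuity and symmetry of the family *)

Section NormContinuity.
Variable R : realType.
Implicit Types (z w : R[i]) (g h : R[i] -> R[i]).

(** Stated with the real-valued [normc], because the norm of [R[i]] takes values in [R[i]]
    itself. *)
Definition normc_cont g z := forall d : R, 0 < d ->
  exists2 e : R, 0 < e & forall w, normc (z - w) < e -> normc (g z - g w) < d.

Lemma normc_contM g h z : normc_cont g z -> normc_cont h z ->
  normc_cont (fun x => g x * h x) z.
Proof.
move=> gc hc d d0.
have a0 := normc_ge0 (g z); have b0 := normc_ge0 (h z).
set a := normc (g z) in a0 *; set b := normc (h z) in b0 *.
(* With u < 1 and u, v < k, the three error terms u b + a v + u v add up to at most k (a + b + 1) =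
   d / 2. *)
pose k := d / (2 * (a + b + 1)).
have k0 : 0 < k by rewrite divr_gt0// mulr_gt0//; lra.
have kE : k * (a + b + 1) = d / 2 by rewrite /k; field; rewrite gt_eqF//; lra.
have m0 : 0 < Num.min 1 k by rewrite lt_min ltr01.
have [e1 e10 g1] := gc _ m0; have [e2 e20 h2] := hc _ m0.
exists (Num.min e1 e2); first by rewrite lt_min e10.
move=> w; rewrite lt_min => /andP[/g1 + /h2].
rewrite !lt_min => /andP[u1 uk] /andP[v1 vk].
have -> : g z * h z - g w * h w = (g z - g w) * h z +
   (g z * (h z - h w) - (g z - g w) * (h z - h w)) by ring.
apply: le_lt_trans (le_normcD _ _) _.
apply: (@le_lt_trans _ _ (normc ((g z - g w) * h z) +
   (normc (g z * (h z - h w)) + normc ((g z - g w) * (h z - h w))))).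
  by rewrite lerD2l; apply: le_trans (le_normcD _ _) _; rewrite normcN.
rewrite !normcM -/a -/b.
have := normc_ge0 (g z - g w); have := normc_ge0 (h z - h w).
by move: (normc (g z - g w)) (normc (h z - h w)) u1 uk v1 vk => u v *; nra.
Qed.

Lemma normc_contX g z k : normc_cont g z -> normc_cont (fun x => g x ^+ k) z.
Proof.
move=> gc; elim: k => [|k IH].
  by move=> d d0; exists 1 => // w _; rewrite !expr0 subrr normc0.
move=> d d0; have [e e0 eH] := normc_contM gc IH d0.
by exists e => // w; rewrite !exprS; exact: eH.
Qed.

Lemma normc_contV g z : g z != 0 -> normc_cont g z ->
  normc_cont (fun x => (g x)^-1) z.
Proof.
move=> gz gc d d0; have a0 : 0 < normc (g z) by rewrite normc_gt0.
set a := normc (g z) in a0 *.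
(* The first bound keeps |g w| above a / 2; the second then makes |g z - g w| / (a |g w|) smaller
   than d. *)
have m0 : 0 < Num.min (a / 2) (d * a * a / 2) by rewrite lt_min !divr_gt0// !mulr_gt0.
have [e e0 eH] := gc _ m0; exists e => // w /eH; rewrite lt_min => /andP[u1 u2].
have wa : a / 2 < normc (g w).
  by have := ler_normcB (g z) (g w); rewrite -/a; lra.
have gw : g w != 0 by rewrite -normc_gt0; lra.
have -> : (g z)^-1 - (g w)^-1 = - (g z - g w) * ((g z)^-1 * (g w)^-1).
  by field; rewrite gz gw.
rewrite !normcM normcN !normcV -/a -invfM ltr_pdivrMr; last by rewrite mulr_gt0//; lra.
apply: lt_trans u2 _.
have : d * a * (a / 2) < d * a * normc (g w) by rewrite ltr_pM2l// mulr_gt0.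
by rewrite -!mulrA.
Qed.

End NormContinuity.

Section Family.
Variables (R : realType) (m n : nat).
Hypotheses (m_gt0 : (0 < m)%N) (n_gt0 : (0 < n)%N).
Implicit Types t z w : R[i].

Lemma eqN1_add1 z : (z == -1) = (1 + z == 0).
Proof. by rewrite addrC addr_eq0. Qed.

Lemma fmn_fin_continuous t z : z != -1 ->
  {for (Some z : sphere R), continuous (fmn m n t)}.
Proof.
move=> z1; have z1' : 1 + z != 0 by rewrite -eqN1_add1.
pose g := fun z => t * z ^+ m * ((1 - z) / (1 + z)) ^+ n.
have gc : normc_cont g z.
  have idc : normc_cont id z by move=> d d0; exists d.
  have cstc c : normc_cont (cst c) z.
    by move=> d d0; exists 1 => // w _; rewrite subrr normc0.
  apply: (@normc_contM R (fun x => t * x ^+ m) (fun x => ((1 - x) / (1 + x)) ^+ n)).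
    by apply: (@normc_contM R (cst t) (fun x => x ^+ m)) => //; exact: normc_contX.
  apply: normc_contX; apply: (@normc_contM R (fun x => 1 - x) (fun x => (1 + x)^-1)).
    by move=> d d0; exists d => // w; rewrite opprD addrACA subrr add0r normc_distC opprK addrC.
  apply: normc_contV => //.
  by move=> d d0; exists d => // w; rewrite opprD addrACA subrr add0r.
move=> U; rewrite /= (negbTE z1) => /nbhs_SomeP[d d0 dU].
have [e e0 eg] := gc _ d0; apply/nbhs_SomeP.
exists (Num.min e (normc (1 + z))); first by rewrite lt_min e0 normc_gt0.
move=> w; rewrite lt_min => /andP[we wz] /=.
have w1 : w != -1.
  apply: contraTneq wz => ->; rewrite opprK addrC ltxx //.
by rewrite /preimage /= (negbTE w1); apply: dU; exact: eg.
Qed.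

Lemma fmn_sigma t p : t != 0 ->
  fmn m n t (sigma p) = sigma (fmn m n ((-1) ^+ (m + n).+1 / t) p).
Proof.
move=> t0; set s := _ / t.
have s0 : s != 0 by rewrite mulf_neq0 ?invr_eq0// expf_neq0// oppr_eq0 oner_eq0.
have f0 c : fmn m n c (Some 0 : sphere R) = Some 0.
  by rewrite /= eq_sym oppr_eq0 oner_eq0 expr0n gtn_eqF// mulr0 mul0r.
have n11 : (1 == -1 :> R[i]) = false.
  by rewrite -subr_eq0 opprK (_ : 1 + 1 = 2%:R)// pnatr_eq0.
have f1 c : fmn m n c (Some 1 : sphere R) = Some 0.
  by rewrite /= n11 subrr mul0r [0 ^+ n]expr0n gtn_eqF// mulr0.
case: p => [z|]; last by rewrite [sigma None]/= f0.
have [->|z0] := eqVneq z 0; first by rewrite f0 /= eqxx.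
have [->|z1] := eqVneq z 1; first by rewrite f1 /= oner_eq0 /= invr1 !eqxx.
have [->|zN1] := eqVneq z (-1).
  rewrite [sigma (Some (-1))]/= oppr_eq0 oner_eq0 invrN1 opprK f1.
  by rewrite /= eqxx.
have z1z : 1 + z != 0 by rewrite -eqN1_add1.
have z1z' : 1 - z != 0 by rewrite subr_eq0 eq_sym.
rewrite [sigma (Some z)]/= (negbTE z0) /fmn /= (negbTE zN1).
have -> : (- z^-1 == -1) = false.
  by rewrite eqr_opp invr_eq1 (negbTE z1).
rewrite /sigma ifN; last first.
  by do !apply: mulf_neq0 => //; rewrite expf_neq0// mulf_neq0// invr_eq0.
congr Some.
rewrite [(- z^-1) ^+ m]exprNn [z^-1 ^+ m]exprVn /s exprS exprD.
have -> : (1 - - z^-1) / (1 + - z^-1) = - ((1 + z) / (1 - z)).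
  by field; rewrite z0 z1z' /= subr_eq0 z1.
rewrite [(- (_ / _)) ^+ n]exprNn !exprMn !exprVn.
(* Each sign is its own inverse; inverting one occurrence of each lets [field] cancel them as opaque
   units. *)
have sgn k : ((-1) ^+ k : R[i]) = ((-1) ^+ k)^-1.
  by rewrite -exprVn invrN1.
have sgn0 k : ((-1) ^+ k : R[i]) != 0 by rewrite expf_neq0// oppr_eq0 oner_eq0.
have zm : z ^+ m != 0 by rewrite expf_neq0.
have zn : (1 + z) ^+ n != 0 by rewrite expf_neq0.
have zn' : (1 - z) ^+ n != 0 by rewrite expf_neq0.
rewrite {1}(sgn m) {1}(sgn n); move: (sgn0 m) (sgn0 n) zm zn zn'.
move: ((-1) ^+ m) ((-1) ^+ n) (z ^+ m) ((1 + z) ^+ n) ((1 - z) ^+ n).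
by move=> a b c u v a0 b0 c0 u0 v0; field; rewrite t0 a0 b0 c0 u0 v0.
Qed.

Lemma fmn_continuous t : t != 0 -> continuous (fmn m n t).
Proof.
move=> t0.
set s := (-1) ^+ (m + n).+1 / t.
have fE : fmn m n t = @sigma R \o (fmn m n s \o @sigma R).
  by apply/funext => p /=; rewrite -fmn_sigma// sigmaK.
(* Conjugation moves the two poles to finite points: [sigma] exchanges -1 with 1 and infinity with
   0. *)
have sc z : z != -1 -> {for (sigma (Some z) : sphere R), continuous (fmn m n t)}.
  move=> z1; rewrite fE.
  apply: continuous_comp; last exact: sigma_continuous.
  apply: continuous_comp; first exact: sigma_continuous.
  by rewrite sigmaK; exact: fmn_fin_continuous.
have n1 : (1 == -1 :> R[i]) = false.
  by rewrite -subr_eq0 opprK (_ : 1 + 1 = 2%:R)// pnatr_eq0.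
case=> [z|].
  have [->|] := eqVneq z (-1); last exact: fmn_fin_continuous.
  have := sc 1; rewrite /= oner_eq0 invr1; apply; by rewrite n1.
by have := sc 0; rewrite /= eqxx eq_sym oppr_eq0 oner_eq0; exact.
Qed.

End Family.

(** * Fibers *)

Section Fibers.
Variables (R : realType) (m n : nat).
Hypotheses (m_gt0 : (0 < m)%N) (n_gt0 : (0 < n)%N).
Variable t : R[i].
Hypothesis t0 : t != 0.
Implicit Types z w x : R[i].

(* Its roots are the fiber over w. As its leading coefficient does not depend on
   w, the distance from a point x to the fiber is controlled by the value at x,
   which makes the fibers depend continuously on w. *)
Definition fiber_poly w : {poly R[i]} :=
  t *: ('X ^+ m * (1 - 'X) ^+ n) - w *: (1 + 'X) ^+ n.

Lemma fiber_polyE w x : (fiber_poly w).[x] =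
  t * (x ^+ m * (1 - x) ^+ n) - w * (1 + x) ^+ n.
Proof. by rewrite /fiber_poly !hornerE. Qed.

Lemma fmn_fiberP z w : fmn m n t (Some z) = Some w <-> root (fiber_poly w) z.
Proof.
(* At the pole -1 the polynomial takes the nonzero value t (-1)^m 2^n, so clearing the denominator
   creates no extra root. *)
rewrite rootE fiber_polyE /=; have [->|z1] := eqVneq z (-1).
  split=> // /eqP; rewrite subrr [0 ^+ n]expr0n gtn_eqF// mulr0 subr0 => /eqP.
  rewrite !mulf_eq0 (negbTE t0) !expf_eq0 oppr_eq0 oner_eq0 andbF opprK /=.
  by rewrite (_ : 1 + 1 = 2%:R)// pnatr_eq0 andbF.
have z1' : 1 + z != 0 by rewrite -eqN1_add1.
have z1n : (1 + z) ^+ n != 0 by rewrite expf_neq0.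
split=> [[<-]|/eqP H].
  by apply/eqP; rewrite expr_div_n; field; rewrite z1n.
congr Some; apply: (mulIf z1n); rewrite expr_div_n; apply/eqP.
by rewrite -subr_eq0 -H; apply/eqP; field; rewrite z1n.
Qed.

Lemma fiber_polyD w w' x :
  (fiber_poly w').[x] = (fiber_poly w).[x] + (w - w') * (1 + x) ^+ n.
Proof. by rewrite !fiber_polyE; ring. Qed.

Lemma fiber_poly_factor w : exists s : seq R[i], size s = (m + n)%N /\
  fiber_poly w = (t * (-1) ^+ n) *: \prod_(a <- s) ('X - a%:P).
Proof.
pose q : {poly R[i]} := 'X ^+ m * (1 - 'X) ^+ n.
have XN : 1 - 'X = - ('X - 1%:P) :> {poly R[i]} by rewrite opprB polyC1.
have X1 : 1 + 'X = 'X - (-1)%:P :> {poly R[i]}.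
  by rewrite polyCN polyC1 opprK addrC.
have qE : q = (-1) ^+ n *: ('X ^+ m * ('X - 1%:P) ^+ n).
  rewrite /q XN [(- ('X - _)) ^+ n]exprNn [LHS]mulrCA -mul_polyC.
  by rewrite rmorphXn rmorphN rmorph1.
have mq : 'X ^+ m * ('X - 1%:P) ^+ n \is @monic R[i].
  by rewrite monicMl ?monicXn// monic_exp// monicXsubC.
have c0 : t * (-1) ^+ n != 0.
  by rewrite mulf_neq0// expf_neq0// oppr_eq0 oner_eq0.
have sq : size (t *: q) = (m + n).+1.
  rewrite qE scalerA size_scale// size_Mmonic ?monic_neq0 ?monicXn//; last first.
    by rewrite monic_exp// monicXsubC.
  by rewrite size_polyXn size_exp_XsubC addSn addnS.
have lq : lead_coef (t *: q) = t * (-1) ^+ n.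
  by rewrite qE scalerA lead_coefZ (eqP mq) mulr1.
(* The part depending on w has degree at most n < m + n, so it affects neither the degree nor the
   leading coefficient. *)
have slt : (size (- (w *: (1 + 'X) ^+ n)) < size (t *: q))%N.
  rewrite sq size_polyN; apply: leq_ltn_trans (size_scale_leq _ _) _.
  by rewrite X1 size_exp_XsubC ltnS -addn1 addnC leq_add2r.
have [s sE] := closed_field_poly_normal (fiber_poly w).
have lc : lead_coef (fiber_poly w) = t * (-1) ^+ n by rewrite lead_coefDl.
exists s; split; last by rewrite sE lc.
have : size (fiber_poly w) = (m + n).+1 by rewrite size_polyDl.
by rewrite sE lc size_scale// size_prod_XsubC => -[].
Qed.

Lemma normc_fiber_poly w : exists s : seq R[i], [/\ size s = (m + n)%N,
  forall x, normc (fiber_poly w).[x] = normc t * \prod_(a <- s) normc (x - a) &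
  forall a, (a \in s) = root (fiber_poly w) a].
Proof.
have [s [ss sE]] := fiber_poly_factor w; exists s; split=> // [x|a]; last first.
  have c0 : t * (-1) ^+ n != 0.
    by rewrite mulf_neq0// expf_neq0// oppr_eq0 oner_eq0.
  by rewrite sE rootZ// root_prod_XsubC.
have n1 : normc (-1 : R[i]) = 1 by rewrite normcN normc1.
rewrite sE hornerZ !normcM normcX n1 expr1n mulr1; congr (_ * _).
elim: s {ss sE} => [|a s IH]; first by rewrite !big_nil hornerC normc1.
by rewrite !big_cons hornerM normcM IH hornerXsubC.
Qed.

Lemma prod_normc_lt (s : seq R[i]) x (d : R) : 0 < d ->
  \prod_(a <- s) normc (x - a) < d ^+ size s ->
  exists2 a, a \in s & normc (x - a) < d.
Proof.
move=> d0; elim: s => [|a s IH]; first by rewrite big_nil expr0 ltxx.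
rewrite big_cons exprS /=; have [xad _|dxa H] := ltP (normc (x - a)) d.
  by exists a; rewrite // mem_head.
have [|b bs xb] := IH; last by exists b; rewrite // in_cons bs orbT.
rewrite -(ltr_pM2l d0); apply: le_lt_trans H.
by rewrite ler_wpM2r// prodr_ge0// => b _; exact: normc_ge0.
Qed.

(** At z the polynomial of w vanishes, so that of w' has modulus |w - w'| |1 + z|^n. Once this is
    below |t| d^(m+n), some root lies within d of z. *)
Lemma fmn_open_fin z w (d : R) : fmn m n t (Some z) = Some w -> 0 < d ->
  exists2 e : R, 0 < e & forall w', normc (w - w') < e ->
    exists2 z', normc (z - z') < d & fmn m n t (Some z') = Some w'.
Proof.
move=> fz d0.
have z1 : 1 + z != 0 by rewrite -eqN1_add1; apply/eqP => z1; move: fz; rewrite z1 /= eqxx.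
have nz1 : 0 < normc (1 + z) ^+ n by rewrite exprn_gt0// normc_gt0.
have nt : 0 < normc t by rewrite normc_gt0.
exists (normc t * d ^+ (m + n) / normc (1 + z) ^+ n).
  by rewrite divr_gt0// mulr_gt0// exprn_gt0.
move=> w' ww'; have [s [ss sE sr]] := normc_fiber_poly w'.
have /fmn_fiberP/eqP Pz := fz.
have [|a as_ za] := @prod_normc_lt s z d d0; last first.
  by exists a => //; apply/fmn_fiberP; rewrite -sr.
rewrite -(ltr_pM2l nt) -sE (fiber_polyD w) Pz add0r normcM normcX ss.
by rewrite -ltr_pdivlMr.
Qed.

(** The roles are reversed: the polynomial of w is evaluated at a point z of the fiber over w'.
    Since z now varies, |1 + z| must be bounded uniformly. *)
Lemma fmn_closed_fin w (O : set R[i]) :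
  (forall z, fmn m n t (Some z) = Some w -> nbhs z O) ->
  exists2 e : R, 0 < e & forall w' z, normc (w - w') < e ->
    fmn m n t (Some z) = Some w' -> O z.
Proof.
move=> fO; have [s [ss sE sr]] := normc_fiber_poly w.
(* One radius serves all the finitely many roots. *)
have [d d0 dO] : exists2 d : R, 0 < d &
    forall a, a \in s -> forall z, normc (z - a) < d -> O z.
  have : forall a, a \in s -> nbhs a O.
    by move=> a; rewrite sr => /fmn_fiberP; exact: fO.
  elim: s {ss sE sr} => [|a s IH] H; first by exists 1.
  have [|d d0 dO] := IH; first by move=> b bs; apply: H; rewrite in_cons bs orbT.
  have /nbhs_complexP[e e0 eO] := H a (mem_head _ _).
  exists (Num.min d e); first by rewrite lt_min d0.
  move=> b; rewrite in_cons => /orP[/eqP->|bs] z; rewrite lt_min => /andP[zd ze].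
    by apply: eO; rewrite normc_distC.
  exact: dO zd.
have nt : 0 < normc t by rewrite normc_gt0.
set W := normc w + 1; have W0 : 0 < W by rewrite ltr_wpDl// normc_ge0.
(* For |z| > 2 one has |1 + z| <= 3 |1 - z|, so the fiber equation gives |t| |z| <= |t| |z|^m <= 3^n
   W, where [W] bounds |w'|. *)
pose M := 2 + 3 ^+ n * W / normc t.
have M0 : 0 < M by rewrite ltr_wpDr// divr_ge0 ?mulr_ge0 ?exprn_ge0// ltW.
have M1 : 0 < (1 + M) ^+ n by rewrite exprn_gt0// addr_gt0.
exists (Num.min 1 (normc t * d ^+ (m + n) / (1 + M) ^+ n)).
  by rewrite lt_min ltr01 divr_gt0// mulr_gt0// exprn_gt0.
move=> w' z; rewrite lt_min => /andP[ww1 ww] /fmn_fiberP/eqP Pz.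
have w'W : normc w' <= W.
  have := ler_normcB w' w; rewrite normc_distC -/W; rewrite /W; lra.
have zM : normc z <= M.
  rewrite leNgt; apply/negP => Mz.
  have z2 : 2 < normc z.
    by apply: le_lt_trans Mz; rewrite lerDl divr_ge0 ?mulr_ge0 ?exprn_ge0// ltW.
  move: Pz; rewrite fiber_polyE => /eqP; rewrite subr_eq0 => /eqP.
  move=> /(congr1 (@normc R)); rewrite !normcM !normcX => H.
  have h1 : normc z - 1 <= normc (1 - z).
    by have := ler_normcB z 1; rewrite normc1 normc_distC.
  have h2 : normc (1 + z) <= 3 * normc (1 - z).
    by have := le_normcD 1 z; rewrite normc1; lra.
  have u0 : 0 < normc (1 - z) ^+ n by rewrite exprn_gt0//; lra.
  have h3 : normc (1 + z) ^+ n <= 3 ^+ n * normc (1 - z) ^+ n.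
    by rewrite -exprMn; apply: lerXn2r; rewrite ?nnegrE ?normc_ge0 ?mulr_ge0 ?normc_ge0.
  have h4 : normc z <= normc z ^+ m.
    by rewrite -[leLHS]expr1 ler_weXn2l//; lra.
  have h5 : normc t * normc z * normc (1 - z) ^+ n <=
      W * (3 ^+ n * normc (1 - z) ^+ n).
    apply: (@le_trans _ _ (normc t * (normc z ^+ m * normc (1 - z) ^+ n))).
      by rewrite -mulrA ler_wpM2l ?(ltW nt)// ler_wpM2r// ltW.
    by rewrite H ler_pM// ?normc_ge0// exprn_ge0// normc_ge0.
  have : normc z <= 3 ^+ n * W / normc t.
    by rewrite ler_pdivlMr// -(ler_pM2r u0); move: h5; lra.
  by move: Mz; rewrite /M; lra.
have [|a as_ za] := @prod_normc_lt s z d d0; last exact: dO za.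
rewrite -(ltr_pM2l nt) -sE (fiber_polyD w') Pz add0r normcM normcX ss.
rewrite normc_distC; apply: (@le_lt_trans _ _ (normc (w - w') * (1 + M) ^+ n)).
  rewrite ler_wpM2l ?normc_ge0//; apply: lerXn2r; rewrite ?nnegrE ?normc_ge0//.
    by rewrite addr_ge0// ltW.
  by apply: le_trans (le_normcD _ _) _; rewrite normc1 lerD2l.
by rewrite -ltr_pdivlMr.
Qed.

Lemma fmn_nbhs_image z w (O : set (sphere R)) : fmn m n t (Some z) = Some w ->
  nbhs (Some z : sphere R) O -> nbhs (Some w : sphere R) (fmn m n t @` O).
Proof.
move=> fz /nbhs_SomeP[d d0 dO]; have [e e0 eH] := fmn_open_fin fz d0.
apply/nbhs_SomeP; exists e => // w' /eH[z' zz' fz'].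
by exists (Some z') => //; exact: dO.
Qed.

Lemma fmn_nbhs_fiber w (O : set (sphere R)) : open O ->
  fmn m n t @^-1` [set Some w] `<=` O ->
  \forall w' \near (Some w : sphere R), fmn m n t @^-1` [set w'] `<=` O.
Proof.
move=> oO fO.
have [z fz|e e0 eH] := @fmn_closed_fin w (Some @^-1` O).
  apply: Some_continuous; apply: open_nbhs_nbhs; split => //.
  exact: fO.
apply/nbhs_SomeP; exists e => // w' ww' [z|//] fz; exact: (eH w').
Qed.

End Fibers.

(** * The basin of 0 *)

Section Estimates.
Variables (R : realType) (m n : nat).
Hypotheses (m_gt1 : (1 < m)%N) (n_gt0 : (0 < n)%N).
Implicit Types (t z w : R[i]) (x : R).

Lemma bernoulli_ge k x : -1 <= x -> 1 + k%:R * x <= (1 + x) ^+ k.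
Proof.
move=> x1; elim: k => [|k IH]; first by rewrite mul0r addr0 expr0.
rewrite exprS -natr1.
have : (1 + x) * (1 + k%:R * x) <= (1 + x) * (1 + x) ^+ k.
  by rewrite ler_wpM2l//; lra.
have : 0 <= k%:R :> R by [].
by move: (_ ^+ k) => y; nra.
Qed.

Local Notation N := (n%:R : R).

Let N_ge1 : 1 <= N. Proof. by rewrite ler1n. Qed.

(* The estimates below hold for |t| <= 5/4: the margin over 1 leaves room for a
   neighbourhood of the parameter. *)
Definition trap_radius : R := (2 * N + 1)^-1.

Lemma trap_radius_gt0 : 0 < trap_radius.
Proof. by have N1 := N_ge1; rewrite invr_gt0; lra. Qed.

Lemma trap_radius_le : trap_radius <= 1 / 3.
Proof.
by have N1 := N_ge1; rewrite /trap_radius -div1r ler_pM2l// lef_pV2 ?posrE; lra.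
Qed.

(** This dictates the radius: (1 + r) / (1 - r) becomes (N + 1) / N, and Bernoulli bounds (1 - 1/(N
    + 1))^n below by 1/(N + 1). *)
Lemma trap_ratio_le :
  ((1 + trap_radius) / (1 - trap_radius)) ^+ n <= N + 1.
Proof.
have N1 := N_ge1.
have -> : (1 + trap_radius) / (1 - trap_radius) = (N / (N + 1))^-1.
  rewrite /trap_radius; field.
  by rewrite !lt0r_neq0//; lra.
have b : (N + 1)^-1 <= (N / (N + 1)) ^+ n.
  have -> : N / (N + 1) = 1 + - (N + 1)^-1 by field; apply: lt0r_neq0; lra.
  apply: le_trans (bernoulli_ge _ _); last first.
    by rewrite lerN2 invf_le1; lra.
  by rewrite le_eqVlt; apply/orP; left; apply/eqP; field; apply: lt0r_neq0; lra.
rewrite exprVn -[leRHS]invrK lef_pV2// posrE; first by rewrite exprn_gt0// divr_gt0//; lra.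
by rewrite invr_gt0; lra.
Qed.

(** As m >= 2, a factor |z| <= r is left over, and r (N + 1) = (N + 1) / (2N + 1) <= 2/3; the rate
    is 5/4 * 2/3 = 5/6. *)
Lemma fmn_contraction t z : normc t <= 5 / 4 -> normc z <= trap_radius ->
  exists2 w, fmn m n t (Some z) = Some w & normc w <= 5 / 6 * normc z.
Proof.
have N1 := N_ge1; move=> t1 zr; have r0 := trap_radius_gt0; have r3 := trap_radius_le.
set r := trap_radius in zr r0 r3 *.
have n0 := normc_ge0 z.
have lo : 1 - r <= normc (1 + z).
  by have := ler_normcB 1 (- z); rewrite normcN normc1 opprK; lra.
have hi : normc (1 - z) <= 1 + r.
  by have := le_normcD 1 (- z); rewrite normcN normc1; lra.
have z1 : z != -1 by rewrite eqN1_add1 -normc_gt0; lra.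
rewrite /= (negbTE z1); eexists; first by [].
rewrite !normcM !normcX normcM normcV.
have q : (normc (1 - z) / normc (1 + z)) ^+ n <= N + 1.
  apply: le_trans trap_ratio_le; apply: lerXn2r.
  - by rewrite nnegrE divr_ge0// normc_ge0.
  - by rewrite nnegrE divr_ge0//; rewrite -/r; lra.
  rewrite -/r ler_pM ?normc_ge0 ?invr_ge0 ?normc_ge0// lef_pV2 ?posrE; lra.
have zm : normc z ^+ m <= normc z * r.
  rewrite -(subnK m_gt1) addn2 !exprS; apply: ler_wpM2l => //.
  rewrite -[leRHS]mulr1; apply: ler_pM => //; first exact: exprn_ge0.
  by apply: exprn_ile1 => //; lra.
have rN : r * (N + 1) <= 2 / 3.
  by rewrite /r /trap_radius mulrC ler_pdivrMr; lra.
apply: (@le_trans _ _ (5 / 4 * (normc z * r) * (N + 1))).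
  apply: ler_pM => //; first by rewrite mulr_ge0 ?exprn_ge0 ?normc_ge0.
    by rewrite exprn_ge0// divr_ge0// normc_ge0.
  by apply: ler_pM => //; rewrite ?exprn_ge0 ?normc_ge0.
have -> : 5 / 4 * (normc z * r) * (N + 1) = 5 / 4 * normc z * (r * (N + 1)) by ring.
have : 5 / 4 * normc z * (r * (N + 1)) <= 5 / 4 * normc z * (2 / 3).
  by apply: ler_wpM2l => //; lra.
lra.
Qed.

Lemma fmn_interval t x : normc t <= 5 / 4 -> 0 <= x <= 1 ->
  exists2 w, fmn m n t (Some x%:C) = Some w & normc w < trap_radius.
Proof.
have N1 := N_ge1; move=> t1 /andP[x0 x1].
have x10 : 0 < 1 + x by lra.
have px : 1 + x%:C = (1 + x)%:C by rewrite rmorphD rmorph1.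
have mx : 1 - x%:C = (1 - x)%:C by rewrite rmorphB rmorph1.
have z1 : x%:C != -1.
  by rewrite eqN1_add1 px -normc_gt0 normc_real normr_gt0 lt0r_neq0.
rewrite /= (negbTE z1); eexists; first by [].
rewrite !normcM !normcX normcM normcV px mx !normc_real !ger0_norm//; [|lra..].
(* From (1 - x)(1 + x) <= 1 follows (1 - x) / (1 + x) <= (1 + x)^-2; Bernoulli does the rest. *)
have q : ((1 - x) / (1 + x)) ^+ n <= ((1 + N * x) ^+ 2)^-1.
  apply: (@le_trans _ _ ((((1 + x) ^+ n) ^+ 2)^-1)).
    rewrite -!exprVn -exprM mulnC exprM; apply: lerXn2r.
    - by rewrite nnegrE divr_ge0//; lra.
    - by rewrite nnegrE exprn_ge0// invr_ge0; lra.
    - rewrite expr2 ler_pM2r ?invr_gt0//.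
      by rewrite -div1r ler_pdivlMr//; nra.
  have Nx : 0 < 1 + N * x by rewrite ltr_pwDl// mulr_ge0//; lra.
  rewrite lef_pV2 ?posrE ?exprn_gt0//; apply: lerXn2r.
  - by rewrite nnegrE ltW.
  - by rewrite nnegrE exprn_ge0// ltW.
  - by apply: bernoulli_ge; lra.
have xm : x ^+ m <= x * x.
  rewrite -(subnK m_gt1) addn2 !exprS mulrA -[leRHS]mulr1; apply: ler_wpM2l.
    exact: mulr_ge0.
  exact: exprn_ile1.
(* 4N x^2 <= 4N x <= (1 + N x)^2, the last step being (1 - N x)^2 >= 0. *)
have key : x * x * ((1 + N * x) ^+ 2)^-1 <= (4 * N)^-1.
  have Nx : 0 < 1 + N * x by rewrite ltr_pwDl// mulr_ge0//; lra.
  rewrite ler_pdivrMr ?exprn_gt0// -[_^-1]mul1r mulrAC ler_pdivlMr; last lra.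
  have h1 : 0 <= (1 - N * x) ^+ 2 by exact: sqr_ge0.
  have h2 : N * x * x <= N * x.
    by rewrite -[leRHS]mulr1 ler_wpM2l// mulr_ge0//; lra.
  move: h1; rewrite !expr2; lra.
apply: (@le_lt_trans _ _ (5 / 4 * (x * x * ((1 + N * x) ^+ 2)^-1))).
  rewrite -mulrA; apply: ler_pM => //; first exact: normc_ge0.
    by rewrite mulr_ge0 ?exprn_ge0// divr_ge0//; lra.
  by apply: ler_pM => //; rewrite ?exprn_ge0// divr_ge0//; lra.
(* 5 / (16 N) < 1 / (2N + 1) because 5 < 6N. *)
apply: (@le_lt_trans _ _ (5 / 4 * (4 * N)^-1)); first by rewrite ler_pM2l.
rewrite /trap_radius -[ltRHS]div1r ltr_pdivlMr; last lra.
rewrite mulrAC ltr_pdivrMr; lra.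
Qed.

Lemma iter_fmn_small t z k : normc t <= 5 / 4 -> normc z <= trap_radius ->
  exists2 w, iter k (fmn m n t) (Some z) = Some w &
    normc w <= (5 / 6) ^+ k * normc z.
Proof.
move=> t1 zr; elim: k => [|k [w fw wz]].
  by exists z; rewrite // expr0 mul1r.
have wr : normc w <= trap_radius.
  apply: le_trans wz _; apply: le_trans zr; rewrite ler_piMl ?normc_ge0//.
  by apply: exprn_ile1; lra.
have [v fv vw] := fmn_contraction t1 wr.
exists v; first by rewrite iterS fw.
by apply: le_trans vw _; rewrite exprS -[leRHS]mulrA ler_wpM2l//; lra.
Qed.

(** Uniformity in both t and z matters: with t fixed it gives the trap at 0, and with t varying it
    gives inactivity. *)
Lemma near_iter_fmn_ball (e : R) : 0 < e -> \forall k \near \oo,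
  forall t z, normc t <= 5 / 4 -> normc z <= trap_radius ->
    ball (Some 0 : sphere R) e (iter k (fmn m n t) (Some z)).
Proof.
move=> e0; have q0 : (GRing.exp (5 / 6 : R)) @ \oo --> (0 : R).
  by apply: cvg_expr; rewrite ger0_norm; lra.
have e2 : 0 < e / 2 by lra.
move/cvgrPdist_lt : q0 => /(_ _ e2) [K _ HK].
exists K => // k /= /HK /= qk t z t1 zr.
have [w -> wz] := iter_fmn_small k t1 zr.
apply: le_lt_trans (chordal_fin_le _ _) _; rewrite sub0r normcN.
have r1 := trap_radius_le.
have q1 : 0 <= (5 / 6) ^+ k :> R by apply: exprn_ge0; lra.
move: qk; rewrite sub0r normrN ger0_norm// => qk.
have : (5 / 6) ^+ k * normc z <= (5 / 6) ^+ k * 1 by rewrite ler_wpM2l//; lra.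
lra.
Qed.

Definition trap_disc : set (sphere R) :=
  [set p | if p is Some z then normc z < trap_radius else False].

Lemma trap_disc_open : open trap_disc.
Proof.
rewrite openE => -[z|//] /= zr; apply/nbhs_SomeP.
exists (trap_radius - normc z); first by rewrite subr_gt0.
by move=> w zw /=; have := ler_normcB w z; rewrite normc_distC; lra.
Qed.

Lemma trap_disc0 : trap_disc (Some 0).
Proof. by rewrite /trap_disc /= normc0 trap_radius_gt0. Qed.

Lemma trap_disc_unif t : normc t <= 5 / 4 ->
  {uniform trap_disc, (fun k => iter k (fmn m n t)) @ \oo --> cst (Some 0 : sphere R)}.
Proof.
move=> t1; apply/uniform_ballP => e e0.
apply: filterS (near_iter_fmn_ball e0) => k H [z|//] zr.
by apply: H => //; exact: ltW.
Qed.

Lemma fmn0 t : fmn m n t (Some 0 : sphere R) = Some 0.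
Proof.
rewrite /= eq_sym oppr_eq0 oner_eq0 expr0n gtn_eqF ?mulr0 ?mul0r//.
exact: ltnW.
Qed.

End Estimates.

Section FiniteBasin.
Variables (R : realType) (m n : nat).
Hypotheses (m_gt1 : (1 < m)%N) (n_gt0 : (0 < n)%N).
Variable t : R[i].
Hypotheses (t0 : t != 0) (t1 : normc t <= 5 / 4).

Let f := fmn m n t.
Let D := @trap_disc R n.
Let A := immediate_basin f (Some 0).
Let m_gt0 : (0 < m)%N. Proof. exact: ltnW. Qed.
Let fc : continuous f. Proof. exact: fmn_continuous. Qed.
Let oD : open D. Proof. exact: trap_disc_open. Qed.
Let D0 : D (Some 0). Proof. exact: trap_disc0. Qed.
Let Du : {uniform D, (fun k => iter k f) @ \oo --> cst (Some 0 : sphere R)}.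
Proof. exact: trap_disc_unif. Qed.

Lemma fmn_trap_disc p : D p -> D (f p).
Proof.
case: p => [z|//] zr; have [w fw wz] := fmn_contraction m_gt1 n_gt0 t1 (ltW zr).
rewrite /f fw; apply: le_lt_trans wz (le_lt_trans _ zr).
by rewrite ler_piMl ?normc_ge0//; lra.
Qed.

Lemma fmn_basin p : basin f D p -> basin f D (f p).
Proof.
by move=> [k Dk]; exists k; rewrite -iterSr iterS; exact: fmn_trap_disc.
Qed.

(** The image of the component is connected, contains the fixed point 0 and stays in the basin. *)
Lemma immediate_basin_invariant p : A p -> A (f p).
Proof.
have Abasin : A `<=` basin f D by exact: immediate_basin_sub.
have A0 : A (Some 0) by exact: immediate_basin_center Du.
move=> Ap; have fA : f @` A `<=` A.
  apply: (connected_basin_sub fc oD Du).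
  - apply: connected_continuous_connected; first exact: component_connected.
    by apply: continuous_subspaceT.
  - by exists (Some 0) => //; exact: fmn0.
  - by move=> _ [q Aq <-]; apply: fmn_basin; exact: Abasin.
by apply: fA; exists p.
Qed.

Let L : set (sphere R) := (fun x : R => Some x%:C) @` `[0, 1].

Lemma unit_interval_connected : connected L.
Proof.
apply: connected_continuous_connected; first exact: segment_connected.
apply: continuous_subspaceT => x U /nbhs_SomeP[d d0 dU].
apply/nbhs_ballP; exists d => //= y; rewrite /ball /= => xy; apply: dU.
by rewrite -rmorphB normc_real.
Qed.

Lemma unit_interval_sub : L `<=` A.
Proof.
apply: (connected_basin_sub fc oD Du).
- exact: unit_interval_connected.
- by exists 0; rewrite //= in_itv /= lexx ler01.
- move=> _ [x x01 <-]; exists 1%N.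
  have [|w fw wr] := @fmn_interval R m n m_gt1 n_gt0 t x t1.
    by move: x01; rewrite /= in_itv.
  by rewrite iterS /f fw.
Qed.

(** Infinity is fixed and outside the disc. Hence [connected_preimage] calls for openness and
    closedness only over finite values, where [fiber_poly] is available. *)
Lemma immediate_basin_fin p : A p -> exists z, p = Some z.
Proof.
case: p => [z _|]; first by exists z.
have Abasin : A `<=` basin f D by exact: immediate_basin_sub.
by move=> /Abasin [k]; rewrite (_ : iter k f None = None)//; elim: k => //= k ->.
Qed.

Lemma fmn_zero p : f p = Some 0 -> L p.
Proof.
case: p => [z|//]; rewrite /f /=; case: eqVneq => // z1 [/eqP].
rewrite !mulf_eq0 (negbTE t0) /= !expf_eq0 => /orP[/andP[_ /eqP->]|].
  by exists 0; rewrite //= in_itv /= lexx ler01.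
move=> /andP[_]; rewrite mulf_eq0 invr_eq0 -(eqN1_add1 z) (negbTE z1) orbF subr_eq0.
move=> /eqP <-; exists 1; first by rewrite /= in_itv /= lexx ler01.
by rewrite rmorph1.
Qed.

Lemma immediate_basin0_completely_invariant : completely_invariant f A.
Proof.
apply/seteqP; split=> p; last exact: immediate_basin_invariant.
have Abasin : A `<=` basin f D by exact: immediate_basin_sub.
have A0 : A (Some 0) by exact: immediate_basin_center Du.
have LA : f @` L `<=` A.
  by move=> _ [q Lq <-]; apply: immediate_basin_invariant; exact: unit_interval_sub.
have L0 : L (Some 0) by apply: fmn_zero; exact: fmn0.
suff sub : f @^-1` A `<=` A by exact: sub.
apply: (connected_basin_sub fc oD Du).
- apply: (@connected_preimage _ _ f A L (Some 0)) => //.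
  + exact: component_connected.
  + exact: unit_interval_connected.
  + by exists (Some 0).
  + by move=> q; exact: fmn_zero.
  + move=> [z|] O Afx; last by have [? ] := immediate_basin_fin Afx.
    have [w fw] := immediate_basin_fin Afx.
    by rewrite fw; exact: fmn_nbhs_image.
  + move=> y O Ay oO; have [w ->] := immediate_basin_fin Ay.
    exact: fmn_nbhs_fiber.
- by rewrite /preimage /mkset /f fmn0.
- move=> q /Abasin [k Dk]; exists k.+1; by rewrite iterSr.
Qed.

End FiniteBasin.

(** * The basin of infinity and the free critical points *)

Section Symmetry.
Variables (R : realType) (m n : nat).
Hypotheses (m_gt1 : (1 < m)%N) (n_gt0 : (0 < n)%N).
Implicit Types t : R[i].

Let m_gt0 : (0 < m)%N. Proof. exact: ltnW. Qed.

Definition dual_param t : R[i] := (-1) ^+ (m + n).+1 / t.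

Lemma normc_dual_param t : normc (dual_param t) = (normc t)^-1.
Proof. by rewrite normcM normcX normcN normc1 expr1n mul1r normcV. Qed.

Lemma iter_fmn_conj t k p : t != 0 ->
  iter k (fmn m n t) p = sigma (iter k (fmn m n (dual_param t)) (sigma p)).
Proof.
move=> t0; elim: k => [|k IH]; first by rewrite sigmaK.
by rewrite !iterS IH fmn_sigma.
Qed.

(** The preimage of the disc under [sigma] is a trap at infinity. Each inclusion holds because
    [sigma] maps one component to a connected set through the other centre, inside the other
    basin. *)
Lemma immediate_basin_conj t : t != 0 -> normc (dual_param t) <= 5 / 4 ->
  immediate_basin (fmn m n t) None =
  @sigma R @^-1` immediate_basin (fmn m n (dual_param t)) (Some 0).
Proof.
move=> t0 s1; set s := dual_param t in s1 *.
have s0 : s != 0 by rewrite mulf_neq0 ?invr_eq0// expf_neq0// oppr_eq0 oner_eq0.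
have fc : continuous (fmn m n t) by exact: fmn_continuous.
have gc : continuous (fmn m n s) by exact: fmn_continuous.
pose D := @trap_disc R n; pose D' := @sigma R @^-1` D.
have oD : open D by exact: trap_disc_open.
have oD' : open D' by apply: open_comp => // p _; exact: sigma_continuous.
have D0 : D (Some 0) by exact: trap_disc0.
have D'0 : D' None by [].
have Du := trap_disc_unif m_gt1 n_gt0 s1.
have Du' : {uniform D', (fun k => iter k (fmn m n t)) @ \oo --> cst (None : sphere R)}.
  apply/uniform_ballP => e e0; move/uniform_ballP : Du => /(_ _ e0).
  apply: filterS => k H p /H {}H; rewrite /cst iter_fmn_conj//.
  by apply: (sigma_ball None _ e).1; rewrite sigmaK.
have basinE p : basin (fmn m n t) D' p <-> basin (fmn m n s) D (sigma p).
  have itE k : sigma (iter k (fmn m n t) p) = iter k (fmn m n s) (sigma p).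
    by rewrite [in LHS]iter_fmn_conj// sigmaK.
  by split=> -[k Dk]; exists k; move: Dk; rewrite /D' /preimage /mkset itE.
have sigma_connected (B : set (sphere R)) : connected B -> connected (@sigma R @` B).
  move=> cB; apply: connected_continuous_connected => //.
  by apply: continuous_subspaceT; exact: sigma_continuous.
apply/seteqP; split=> p pA.
- have sub : @sigma R @` immediate_basin (fmn m n t) None `<=`
      immediate_basin (fmn m n s) (Some 0).
    apply: (connected_basin_sub gc oD Du).
    + by apply: sigma_connected; exact: component_connected.
    + by exists None => //; exact: immediate_basin_center Du'.
    + move=> _ [q qA <-]; apply/basinE.
      exact: (immediate_basin_sub fc oD' D'0 Du').
  by apply: sub; exists p.
- have sub : @sigma R @` immediate_basin (fmn m n s) (Some 0) `<=`
      immediate_basin (fmn m n t) None.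
    apply: (connected_basin_sub fc oD' Du').
    + by apply: sigma_connected; exact: component_connected.
    + by exists (Some 0); [exact: immediate_basin_center Du|rewrite /= eqxx].
    + move=> _ [q qA <-]; apply/basinE; rewrite sigmaK.
      exact: (immediate_basin_sub gc oD D0 Du).
  by rewrite -[p]sigmaK; apply: sub; exists (sigma p).
Qed.

Lemma immediate_basin_infty_completely_invariant t : t != 0 ->
  normc (dual_param t) <= 5 / 4 ->
  completely_invariant (fmn m n t) (immediate_basin (fmn m n t) None).
Proof.
move=> t0 s1; rewrite immediate_basin_conj//.
set s := dual_param t in s1 *.
have s0 : s != 0 by rewrite mulf_neq0 ?invr_eq0// expf_neq0// oppr_eq0 oner_eq0.
have := immediate_basin0_completely_invariant m_gt1 n_gt0 s0 s1.
rewrite /completely_invariant => inv.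
have E : @sigma R \o fmn m n t = fmn m n s \o @sigma R.
  by apply/funext => p /=; rewrite -[p in LHS]sigmaK fmn_sigma// sigmaK.
by rewrite -comp_preimage E comp_preimage inv.
Qed.

End Symmetry.

Section FreeCriticalPoints.
Variables (R : realType) (m n : nat).
Hypotheses (m_gt1 : (1 < m)%N) (n_gt0 : (0 < n)%N).
Implicit Types t : R[i].

(** With k = n/m, this is k < sqrt (1 + k^2) <= 1 + k. *)
Lemma alpha_unit_interval : exists2 a : R, 0 < a <= 1 & alpha R m n = a%:C.
Proof.
rewrite /alpha; set k := _ / _; eexists; last by [].
have k0 : 0 < k by rewrite divr_gt0// ltr0n// ltnW.
have := sqrt1_sqr_le (ltW k0).
have : k < Num.sqrt (1 + k ^+ 2).
  rewrite -[ltLHS]ger0_norm ?(ltW k0)// -sqrtr_sqr ltr_sqrt ?ltrDr//.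
  by rewrite ltr_pwDl// sqr_ge0.
by move=> *; apply/andP; split; lra.
Qed.

(** The critical points are the roots of z^2 + 2 (n/m) z - 1, whose product is -1. *)
Lemma sigma_alpha : sigma (Some (alpha R m n)) = Some (beta R m n).
Proof.
have [a /andP[a0 _] aE] := alpha_unit_interval.
have al0 : alpha R m n != 0.
  by rewrite aE -normc_gt0 normc_real normr_gt0 lt0r_neq0.
rewrite /= (negbTE al0); congr Some; apply: (mulIf al0).
rewrite mulNr mulVf// /alpha /beta -rmorphM /=; set k := _ / _.
have k1 : 0 <= 1 + k ^+ 2 by rewrite addr_ge0// sqr_ge0.
have -> : (- k - Num.sqrt (1 + k ^+ 2)) * (- k + Num.sqrt (1 + k ^+ 2)) =
    k ^+ 2 - Num.sqrt (1 + k ^+ 2) ^+ 2 by ring.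
by rewrite sqr_sqrtr// opprD addrCA subrr addr0 rmorphN rmorph1.
Qed.

Lemma near_iter_alpha_ball (e : R) : 0 < e -> \forall k \near \oo,
  forall t, normc t <= 5 / 4 ->
    ball (Some 0 : sphere R) e (iter k (fmn m n t) (Some (alpha R m n))).
Proof.
move=> /(near_iter_fmn_ball m_gt1 n_gt0)[K _ HK].
have [a /andP[a0 a1] ->] := alpha_unit_interval.
(* One extra iterate brings [alpha] into the trap disc, for all admissible t at once. *)
exists K.+1 => // -[//|k] /= Kk t t1; rewrite -iterS iterSr.
have [|w -> wr] := fmn_interval m_gt1 n_gt0 t1 (x := a); first by rewrite ltW.
by apply: HK => //; exact: ltW.
Qed.

Lemma inactiveP (c t0 : R[i]) (d : R) (g : sphere R) : 0 < d ->
  (forall t, normc (t0 - t) < d -> t != 0) ->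
  (forall e, 0 < e -> \forall k \near \oo, forall t, normc (t0 - t) < d ->
    ball g e (iter k (fmn m n t) (Some c))) ->
  inactive m n c t0.
Proof.
move=> d0 U0 H; exists [set t | normc (t0 - t) < d]; split=> //.
- split; last by rewrite /= subrr normc0.
  rewrite openE => t /= td; apply/nbhs_complexP.
  exists (d - normc (t0 - t)); first by rewrite subr_gt0.
  move=> w tw /=; have := le_normcD (t0 - t) (t - w).
  by rewrite addrA subrK; lra.
- apply: (@normal_range_uniform_cvg R _ _ _ (cst g)).
  by apply/uniform_ballP => e /H.
Qed.

Lemma alpha_inactive t : t != 0 -> normc t <= 1 -> inactive m n (alpha R m n) t.
Proof.
move=> t0 t1; have nt : 0 < normc t by rewrite normc_gt0.
(* The radius |t| avoids the parameter 0, and 1/4 keeps the parameters within 5/4. *)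
apply: (@inactiveP _ _ (Num.min (normc t) (1 / 4)) (Some 0)).
- by rewrite lt_min nt; lra.
- move=> u; rewrite lt_min => /andP[tu _]; rewrite -normc_gt0.
  by have := ler_normcB t u; lra.
- move=> e /near_iter_alpha_ball; apply: filterS => k H u.
  rewrite lt_min => /andP[_ tu]; apply: H.
  by have := ler_normcB u t; rewrite normc_distC; lra.
Qed.

Lemma beta_inactive t : 1 <= normc t -> inactive m n (beta R m n) t.
Proof.
(* Radius 1/5 forces |u| > 4/5, that is, a dual parameter of modulus below 5/4. *)
move=> t1; have nt u : normc (t - u) < 1 / 5 -> 4 / 5 < normc u.
  by have := ler_normcB t u; lra.
have u0 u : normc (t - u) < 1 / 5 -> u != 0.
  by move=> /nt; rewrite -normc_gt0; lra.
apply: (@inactiveP _ _ (1 / 5) None) => //.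
move=> e /near_iter_alpha_ball; apply: filterS => k H u tu.
rewrite -sigma_alpha iter_fmn_conj ?u0 ?(ltnW m_gt1)// sigmaK.
apply: (sigma_ball None _ e).1; rewrite sigmaK; apply: H.
rewrite normc_dual_param -[leRHS]invrK lef_pV2 ?posrE; have := nt _ tu; lra.
Qed.

End FreeCriticalPoints.

Theorem mainTheorem1 (R : realType) (m n : nat) (hm : (2 <= m)%N)
    (hn : (1 <= n)%N) :
  [/\ forall t : R[i], 0 < `|t| -> `|t| <= 1 ->
        completely_invariant (fmn m n t)
          (immediate_basin (fmn m n t) (Some 0)),
      forall t : R[i], 1 <= `|t| ->
        completely_invariant (fmn m n t)
          (immediate_basin (fmn m n t) None) &
      forall t : R[i], t != 0 ->
        inactive m n (alpha R m n) t \/ inactive m n (beta R m n) t].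
Proof.
split=> [t|t|t t0].
- rewrite normr_gt0 lecR -/(normc t) => t0 t1.
  apply: immediate_basin0_completely_invariant => //; lra.
- rewrite lecR -/(normc t) => t1.
  have t0 : t != 0 by rewrite -normc_gt0; lra.
  apply: immediate_basin_infty_completely_invariant => //.
  by rewrite normc_dual_param; apply: le_trans (_ : 1 <= _); [rewrite invf_le1//|]; lra.
- have [t1|t1] := leP (normc t) 1; first by left; exact: alpha_inactive.
  by right; apply: beta_inactive => //; exact: ltW.
Qed.
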